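(* Let $R$ be a P$v$MD and consider the conditions: (i) $R$ is a weakly Matlis domain; (ii) $R$ has $t$-finite character; (iii) $R$ has the $t\#\#$-property; (iv) $R$ is a $tRTP$-domain. Then (i) $\Rightarrow$ (ii) $\Rightarrow$ (iii) $\Rightarrow$ (iv). If in addition each $t$-prime ideal of $R$ is contained in a unique $t$-maximal ideal, then all four conditions are equivalent.
   Context: $R$ is an integral domain with quotient field $K\neq R$. For nonzero $R$-submodules $A,B$ of $K$, $(A:B)=\{x\in K: xB\subseteq A\}$. For a nonzero fractional ideal $I$, $I_v=(R:(R:I))$, $I_t=\bigcup\{J_v: J\subseteq I\text{ nonzero finitely generated}\}$; $I$ is a $t$-ideal if $I=I_t$; a $t$-prime is a prime $t$-ideal; a $t$-maximal ideal is an ideal maximal among proper $t$-ideals. $R$ is a P$v$MD if $R_M$ is a valuation domain for every $t$-maximal $M$. $R$ has $t$-finite character if each nonzero element of $R$ lies in at most finitely many $t$-maximal ideals. $R$ is weakly Matlis if it has $t$-finite character and each $t$-prime ideal is contained in a unique $t$-maximal ideal. $R$ has the $t\#\#$-property if $\bigcap_{P\in\mathcal P_1}R_P\neq\bigcap_{P\in\mathcal P_2}R_P$ for any two distinct sets $\mathcal P_1,\mathcal P_2$ of pairwise incomparable $t$-primes. $R$ is a $tRTP$-domain if for each nonzero ideal $I$, either $(I(R:I))_t=R$ or $(I(R:I))_t$ is a radical ideal. *)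

(* Defs.v *)
From HB Require Import structures.
From mathcomp Require Import all_boot all_order all_algebra fraction.
Set Implicit Arguments.
Unset Strict Implicit.
Unset Printing Implicit Defensive.
Import GRing.Theory.
Local Open Scope ring_scope.

(* R : idomainType, K := {fraction R} its quotient field.
   R-submodules of K (and ideals of R, viewed inside K) are predicates K -> Prop. *)

Definition emb (R : idomainType) (r : R) : {fraction R} := FracField.tofrac r.

Section Defs.
Context (R : idomainType).
Local Notation K := {fraction R}.

Definition Rsub (x : K) : Prop := exists r : R, x = emb r.

Definition subsetK (A B : K -> Prop) : Prop := forall x, A x -> B x.

Definition nonzeroK (A : K -> Prop) : Prop := exists x, A x /\ x != 0.

Definition is_submod (A : K -> Prop) : Prop :=
  A 0 /\ (forall x y, A x -> A y -> A (x + y)) /\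
  (forall (r : R) x, A x -> A (emb r * x)).

Definition frac_ideal (A : K -> Prop) : Prop :=
  is_submod A /\ exists d : R, d != 0 /\ forall x, A x -> Rsub (emb d * x).

Definition colon (A B : K -> Prop) : K -> Prop :=
  fun x => forall b, B b -> A (x * b).

Definition vclos (I : K -> Prop) : K -> Prop := colon Rsub (colon Rsub I).

Definition span (s : seq K) : K -> Prop :=
  fun x => exists c : seq R, x = \sum_(i < size s) emb (nth 0 c i) * nth 0 s i.

Definition fin_gen (J : K -> Prop) : Prop :=
  exists s : seq K, forall x, J x <-> span s x.

Definition tclos (I : K -> Prop) : K -> Prop :=
  fun x => exists J : K -> Prop,
    is_submod J /\ fin_gen J /\ nonzeroK J /\ subsetK J I /\ vclos J x.

Definition prodK (A B : K -> Prop) : K -> Prop :=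
  fun x => exists l : seq (K * K),
    (forall p, p \in l -> A p.1 /\ B p.2) /\ x = \sum_(p <- l) p.1 * p.2.

Definition ideal (I : K -> Prop) : Prop := is_submod I /\ subsetK I Rsub.

Definition proper (I : K -> Prop) : Prop := ~ I 1.

Definition prime_ideal (P : K -> Prop) : Prop :=
  ideal P /\ proper P /\
  forall a b, Rsub a -> Rsub b -> P (a * b) -> P a \/ P b.

Definition t_ideal (I : K -> Prop) : Prop :=
  ideal I /\ nonzeroK I /\ forall x, I x <-> tclos I x.

Definition t_prime (P : K -> Prop) : Prop := prime_ideal P /\ t_ideal P.

Definition t_maximal (M : K -> Prop) : Prop :=
  t_ideal M /\ proper M /\
  forall N, t_ideal N -> proper N -> subsetK M N -> subsetK N M.

Definition loc (P : K -> Prop) : K -> Prop :=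
  fun x => exists a s, Rsub a /\ Rsub s /\ ~ P s /\ x = a / s.

(* a subring V of K with quotient field K is a valuation domain *)
Definition valuation (V : K -> Prop) : Prop :=
  forall x, x != 0 -> V x \/ V x^-1.

Definition PvMD : Prop := forall M, t_maximal M -> valuation (loc M).

Definition t_finite_character : Prop :=
  forall r : R, r != 0 ->
    exists (n : nat) (f : nat -> K -> Prop),
      forall M, t_maximal M -> M (emb r) ->
        exists i, (i < n)%N /\ forall x, M x <-> f i x.

Definition unique_t_max_over_t_primes : Prop :=
  forall P, t_prime P ->
    (exists M, t_maximal M /\ subsetK P M) /\
    (forall M1 M2, t_maximal M1 -> t_maximal M2 ->
       subsetK P M1 -> subsetK P M2 -> forall x, M1 x <-> M2 x).

Definition weakly_Matlis : Prop :=
  t_finite_character /\ unique_t_max_over_t_primes.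

(* sets of ideals are predicates on (K -> Prop); distinctness is Leibniz
   inequality (extensional under functional/propositional extensionality) *)
Definition pairwise_incomparable_t_primes (F : (K -> Prop) -> Prop) : Prop :=
  (forall P, F P -> t_prime P) /\
  (forall P Q, F P -> F Q -> subsetK P Q -> P = Q).

Definition bigcap_loc (F : (K -> Prop) -> Prop) : K -> Prop :=
  fun x => forall P, F P -> loc P x.

Definition t_sharpsharp : Prop :=
  forall F1 F2, pairwise_incomparable_t_primes F1 ->
    pairwise_incomparable_t_primes F2 -> F1 <> F2 ->
    bigcap_loc F1 <> bigcap_loc F2.

Definition radical (I : K -> Prop) : Prop :=
  forall x, Rsub x -> forall n : nat, I (x ^+ n) -> I x.

Definition tRTP : Prop :=
  forall I, ideal I -> nonzeroK I ->
    let J := tclos (prodK I (colon Rsub I)) in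
    (forall x, J x <-> Rsub x) \/ radical J.

Definition not_field : Prop := ~ (forall x : K, Rsub x).

End Defs.

(* Main.v *)
(** Everything is checked locally: in a PvMD, [R] and every t-ideal are the
    intersections of their localizations at the t-maximal ideals, and [loc P] is a
    valuation domain for each t-prime [P].

    (ii) => (iii). If [P] in [F1] lies in no member of [F2], then t-finite
    character, together with the comparability of primes below one t-maximal
    ideal, gives a finite subset of [P] contained in no member of [F2]. It
    generates a principal ideal [(f)] at [P], and some [t / f] with [t] outside [P]
    belongs to [loc Q] for every [Q] in [F2] but not to [loc P].

    (iii) => (iv). Comparing the sets [{P} + A] and [A], where [A] consists of the
    t-maximal ideals not containing [P], gives [x] outside [loc P] lying in
    [loc N] for all [N] in [A]. Let [J] be the t-closure of the trace [I(R:I)],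
    [M] a t-maximal ideal over [J], and [P] the radical of [J] in [loc M]. If
    [y] multiplies [I] into [loc P], powers of [x] absorb the denominators of [y]
    away from [P], so [P y] lies in [(R:I)] locally at [M]; this forces [P] into
    [J] at [M].

    (iv) => (ii), under uniqueness. Let [M] be t-maximal, [r] in [M] nonzero, [P]
    the radical of [r] in [loc M], and [I] the contraction of [r^2 loc M]. If
    [(R:I)] were inside [loc P], the radical closure of [I(R:I)] would put [r] in
    [r^2 loc P]. Hence some [x] in [(R:I)] is not in [loc P], and it yields an
    element outside [M] lying in all other t-maximal ideals over [r]. So the
    t-ideal of elements lying in all but finitely many t-maximal ideals over [r]
    is contained in no t-maximal ideal. *)

Require Import Defs.
From mathcomp Require Import all_boot all_order all_algebra fraction.
From mathcomp Require Import boolp classical_sets ring.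
Import Defs.
Set Implicit Arguments.
Unset Strict Implicit.
Unset Printing Implicit Defensive.
Import GRing.Theory.
Local Open Scope ring_scope.

(** * Submodules of the quotient field and the t-closure *)

Lemma fraction_denominator (R : idomainType) (x : {fraction R}) :
  exists2 d : R, d != 0 & Rsub (emb d * x).
Proof.
elim/quotW: x => y; exists (frac y).2; first exact: denom_ratioP.
exists (frac y).1; rewrite /emb; unlock FracField.tofrac.
rewrite -[LHS]FracField.pi_mul; apply/eqmodP/eqP => /=.
by rewrite !numden_Ratio ?mulf_neq0 ?oner_neq0 ?denom_ratioP //; ring.
Qed.

Section Ideals.
Context (R : idomainType).
Local Notation K := {fraction R}.
Implicit Types (I J M P Q A B : K -> Prop) (x y z : K) (s : seq K).

Lemma emb_neq0 (r : R) : (emb r != 0) = (r != 0).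
Proof. by rewrite /emb tofrac_eq0. Qed.

Lemma Rsub0 : Rsub (0 : K).
Proof. by exists 0; rewrite /emb rmorph0. Qed.

Lemma Rsub1 : Rsub (1 : K).
Proof. by exists 1; rewrite /emb rmorph1. Qed.

Lemma RsubD x y : Rsub x -> Rsub y -> Rsub (x + y).
Proof. by move=> [a ->] [b ->]; exists (a + b); rewrite /emb rmorphD. Qed.

Lemma RsubM x y : Rsub x -> Rsub y -> Rsub (x * y).
Proof. by move=> [a ->] [b ->]; exists (a * b); rewrite /emb rmorphM. Qed.

Lemma RsubX x n : Rsub x -> Rsub (x ^+ n).
Proof. by move=> [a ->]; exists (a ^+ n); rewrite /emb rmorphXn. Qed.

Lemma submod0 A : is_submod A -> A 0. Proof. by case. Qed.

Lemma submodD A x y : is_submod A -> A x -> A y -> A (x + y).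
Proof. by case=> _ [+ _]; apply. Qed.

Lemma submodM A a x : is_submod A -> Rsub a -> A x -> A (a * x).
Proof. by case=> _ [_ +] [r ->]; apply. Qed.

Lemma submodMr A a x : is_submod A -> Rsub a -> A x -> A (x * a).
Proof. by rewrite mulrC; apply: submodM. Qed.

Lemma is_submodP A : A 0 -> (forall x y, A x -> A y -> A (x + y)) ->
  (forall a x, Rsub a -> A x -> A (a * x)) -> is_submod A.
Proof. by move=> A0 AD AM; split=> //; split=> // r x; apply: AM; exists r. Qed.

Lemma Rsub_submod : is_submod (@Rsub R).
Proof.
by apply: is_submodP; [exact: Rsub0 | exact: RsubD | exact: RsubM].
Qed.

Lemma submod_sum A (T : Type) (r : seq T) (F : T -> K) :
  is_submod A -> (forall i, A (F i)) -> A (\sum_(i <- r) F i).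
Proof.
move=> sA AF; apply: (big_ind A) => //; first exact: submod0.
by move=> x y; apply: submodD.
Qed.

Lemma colon_submod A B : is_submod A -> is_submod (colon A B).
Proof.
move=> sA; apply: is_submodP => [b Bb|x y Ax Ay b Bb|a x Ra Ax b Bb].
- by rewrite mul0r; apply: submod0.
- by rewrite mulrDl; apply: submodD => //; [apply: Ax|apply: Ay].
- by rewrite -mulrA; apply: submodM => //; apply: Ax.
Qed.

Lemma span_submod s : is_submod (span s).
Proof.
apply: is_submodP => [|x y [c ->] [d ->]|_ x [a ->] [c ->]].
- exists [::]; rewrite big1 // => i _.
  by rewrite nth_nil /emb rmorph0 mul0r.
- exists (mkseq (fun i => nth 0 c i + nth 0 d i) (size s)).
  rewrite -big_split; apply: eq_bigr => i _.
  by rewrite nth_mkseq // /emb rmorphD mulrDl.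
- exists (mkseq (fun i => a * nth 0 c i) (size s)).
  rewrite mulr_sumr; apply: eq_bigr => i _.
  by rewrite nth_mkseq // /emb rmorphM mulrA.
Qed.

Lemma mem_span s g : g \in s -> span s g.
Proof.
move=> gs; exists (mkseq (fun i => (i == index g s)%:R) (size s)).
have ltg : (index g s < size s)%N by rewrite index_mem.
rewrite (bigD1 (Ordinal ltg)) //= nth_mkseq // eqxx nth_index //.
rewrite /emb rmorph1 mul1r big1 ?addr0 // => i ne_i.
rewrite nth_mkseq // (_ : (i : nat) == index g s = false).
  by rewrite rmorph0 mul0r.
by apply/negP => /eqP e; case/eqP: ne_i; apply: val_inj.
Qed.

Lemma span_sub A s : is_submod A -> (forall g, g \in s -> A g) ->
  subsetK (span s) A.
Proof.
move=> sA As x [c ->]; apply: submod_sum => // i.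
by apply: submodM => //; [exists (nth 0 c i)|apply: As; rewrite mem_nth].
Qed.

(* Quantifying over generating lists instead of submodules; [y] ranges over
   [(R : s)], so the last clause says that [x] is in the [v]-closure of [s]. *)
Lemma tclosP I x : is_submod I -> tclos I x <->
  exists s, [/\ forall g, g \in s -> I g, exists2 g, g \in s & g != 0 &
    forall y, (forall g, g \in s -> Rsub (y * g)) -> Rsub (x * y)].
Proof.
move=> sI; split=> [[J [sJ [[s Js] [[z [Jz nz_z]] [JI Jx]]]]]|[s [sI' [g gs nz_g] sx]]].
- exists s; split=> [g gs||y sy].
  + by apply/JI/Js/mem_span.
  + apply: contrapT => s0; case/eqP: nz_z.
    have: span s z by apply/Js.
    apply: (span_sub (A := fun z => z = 0)).
      by apply: is_submodP => // [? ? -> ->|? ? _ ->]; rewrite ?addr0 ?mulr0.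
    move=> g gs; apply: contrapT => /eqP nz_g; apply: s0; by exists g.
  + apply: Jx => b /Js; apply: (span_sub (A := fun z => Rsub (y * z))) => //.
    apply: is_submodP => [|u v|a u]; first by rewrite mulr0; apply: Rsub0.
      by rewrite mulrDr; apply: RsubD.
    by rewrite mulrCA; apply: RsubM.
- exists (span s); split; first exact: span_submod.
  split; first by exists s.
  split; first by exists g; split=> //; apply: mem_span.
  split; first exact: span_sub.
  by move=> y Iy; apply: sx => h hs; apply/Iy/mem_span.
Qed.

(** Leaves out the integrality and nonvanishing built into [t_ideal]; [t_closed_ideal] restores
    them. *)
Definition t_closed J := is_submod J /\ subsetK (tclos J) J.

Lemma sub_tclos I : is_submod I -> nonzeroK I -> subsetK I (tclos I).
Proof.
move=> sI [z [Iz nz_z]] x Ix; apply/tclosP=> //; exists [:: z; x]; split.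
- by move=> g; rewrite !inE => /orP[] /eqP->.
- by exists z; rewrite ?inE ?eqxx.
- by move=> y sy; rewrite mulrC; apply: sy; rewrite !inE eqxx orbT.
Qed.

Lemma tclos_mono I J : subsetK I J -> subsetK (tclos I) (tclos J).
Proof.
move=> IJ x [F [sF [fF [nF [FI Fx]]]]]; exists F; split=> //; split=> //.
by split=> //; split=> // z /FI /IJ.
Qed.

Lemma tclos_submod I : is_submod I -> nonzeroK I -> is_submod (tclos I).
Proof.
move=> sI nI; apply: is_submodP => [|x y|a x Ra].
- by apply: sub_tclos => //; apply: submod0.
- move=> /(tclosP _ sI)[s [Is [g gs nz_g] sx]] /(tclosP _ sI)[s' [Is' _ sy]].
  apply/(tclosP _ sI); exists (s ++ s'); split.
  + by move=> h; rewrite mem_cat => /orP[/Is|/Is'].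
  + by exists g; rewrite ?mem_cat ?gs.
  + move=> z sz; rewrite mulrDl; apply: RsubD; [apply: sx|apply: sy] => h hs;
      by apply: sz; rewrite mem_cat hs ?orbT.
- move=> /(tclosP _ sI)[s [Is ns sx]]; apply/(tclosP _ sI); exists s; split=> // y sy.
  by rewrite -mulrA; apply: RsubM => //; apply: sx.
Qed.

(** Each of the finitely many elements of [s] needs only finitely many elements of [I]; the
    concatenation [l] of these lists serves for all of [s] at once. *)
Lemma tclos_idem I : is_submod I -> nonzeroK I ->
  subsetK (tclos (tclos I)) (tclos I).
Proof.
move=> sI nI x /(tclosP _ (tclos_submod sI nI))[s [Is [g gs nz_g] sx]].
have [l [Il nl ly]] : exists l : seq K, [/\ forall h, h \in l -> I h,
    (exists2 h, h \in l & h != 0) &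
    forall y, (forall h, h \in l -> Rsub (y * h)) ->
      forall g, g \in s -> Rsub (y * g)].
  have [z [Iz nz_z]] := nI.
  elim: s {g gs nz_g sx} Is => [|g s IHs] Is.
    exists [:: z]; split=> // [h|]; first by rewrite inE => /eqP->.
    by exists z; rewrite ?inE.
  have [h hs|l [Il [h hl nz_h] ly]] := IHs; first by apply: Is; rewrite inE hs orbT.
  have /(tclosP _ sI)[l' [Il' _ ly']] : tclos I g by apply: Is; rewrite inE eqxx.
  exists (l ++ l'); split.
  - by move=> k; rewrite mem_cat => /orP[/Il|/Il'].
  - by exists h; rewrite ?mem_cat ?hl.
  - move=> y yl k; rewrite inE => /orP[/eqP->|ks].
      by rewrite mulrC; apply: ly' => j jl; apply: yl; rewrite mem_cat jl orbT.
    by apply: ly ks => j jl; apply: yl; rewrite mem_cat jl.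
by apply/(tclosP _ sI); exists l; split=> // y yl; apply: sx; apply: ly.
Qed.

Lemma tclos_t_closed I : is_submod I -> nonzeroK I -> t_closed (tclos I).
Proof. by move=> sI nI; split; [apply: tclos_submod|apply: tclos_idem]. Qed.

Lemma Rsub_t_closed : t_closed (@Rsub R).
Proof.
split=> [|x /(tclosP _ Rsub_submod)[s [Is _ sx]]]; first exact: Rsub_submod.
by rewrite -[x]mulr1; apply: sx => g /Is; rewrite mul1r.
Qed.

Lemma t_ideal_closed I : t_ideal I -> t_closed I.
Proof. by case=> -[sI _] [_ It]; split=> // x /It. Qed.

Lemma t_closed_ideal I : t_closed I -> nonzeroK I -> subsetK I (@Rsub R) ->
  t_ideal I.
Proof.
move=> [sI tI] nI IR; split; first by split.
by split=> // x; split=> [|/tI//]; apply: sub_tclos.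
Qed.

(** Scaling a list by a nonzero [x] turns a witness for [z] in the t-closure of the multiplier ideal
    into a witness for [z * x] in that of [J]. *)
Lemma multiplier_t_closed J x : t_closed J ->
  t_closed (fun r => Rsub r /\ J (r * x)).
Proof.
move=> [sJ tJ].
have sC : is_submod (fun r => Rsub r /\ J (r * x)).
  apply: is_submodP => [|u v [Ru Ju] [Rv Jv]|a u Ra [Ru Ju]].
  - by rewrite mul0r; split; [apply: Rsub0|apply: submod0].
  - by rewrite mulrDl; split; [apply: RsubD|apply: submodD].
  - by rewrite -mulrA; split; [apply: RsubM|apply: submodM].
split=> // z tz; split.
  by apply: (proj2 Rsub_t_closed); apply: tclos_mono tz => ? [].
have [->|nz_x] := eqVneq x 0; first by rewrite mulr0; apply: submod0.
have /(tclosP _ sC)[s [Cs [g gs nz_g] sz]] := tz.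
apply/tJ/tclosP => //; exists [seq h * x | h <- s]; split.
- by move=> _ /mapP[h hs ->]; case: (Cs _ hs).
- by exists (g * x); [apply: map_f|rewrite mulf_neq0].
- move=> y sy; rewrite -mulrA; apply: sz => h hs.
  by rewrite (_ : _ * h = y * (h * x)); [apply/sy/map_f|ring].
Qed.

Lemma subsetK_antisym A B : subsetK A B -> subsetK B A -> A = B.
Proof. by move=> AB BA; apply/predeqP => x; split; [apply: AB|apply: BA]. Qed.

Lemma not_subsetK A B : ~ subsetK A B -> exists x, A x /\ ~ B x.
Proof.
move=> nAB; apply: contrapT => no; apply: nAB => x Ax; apply: contrapT => nBx.
by apply: no; exists x.
Qed.

(** * Existence and primality of t-maximal ideals, and the local-global principle *)

Lemma t_maximal_eq M N : t_maximal M -> t_maximal N -> subsetK M N -> M = N.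
Proof.
move=> [tM [pM maxM]] [tN [pN _]] MN; apply: subsetK_antisym => //.
exact: maxM.
Qed.

(** Zorn's lemma applies because membership in a t-closure is witnessed by a finite list, which lies
    in a single member of a chain. *)
Lemma t_ideal_in_t_maximal J : t_ideal J -> proper J ->
  exists2 M, t_maximal M & subsetK J M.
Proof.
move=> tJ pJ.
pose good (N : set K) := [/\ t_ideal N, proper N & subsetK J N].
have [|M [gM maxM]] := @Zorn_bigcup K (fun N => N = set0 \/ good N).
  move=> F Fgood chain.
  have [[N0 [FN0 gN0]]|noF] := EM (exists N, F N /\ good N); last first.
    left; rewrite -subset0 => x [N FN Nx].
    by case: (Fgood _ FN) => [N0|gN]; [rewrite N0 in Nx | case: noF; exists N].
  right; set U := bigcup _ _.
  have Fx N x : F N -> N x -> good N.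
    by move=> FN Nx; case: (Fgood _ FN) => // e; rewrite e in Nx.
  have sup s : (forall g, g \in s -> U g) ->
      exists N, [/\ F N, good N & forall g, g \in s -> N g].
    elim: s => [|g s IHs] Us; first by exists N0.
    have [h hs|N [FN gN Ns]] := IHs; first by apply: Us; rewrite inE hs orbT.
    have [N' FN' N'g] := Us _ (mem_head _ _).
    have [NN'|N'N] := chain _ _ FN FN'.
      exists N'; split=> //; first exact: Fx N'g.
      by move=> h; rewrite inE => /orP[/eqP->//|/Ns/NN'].
    by exists N; split=> // h; rewrite inE => /orP[/eqP->|/Ns//]; apply: N'N.
  have JU : subsetK J U by move=> x Jx; exists N0 => //; case: gN0 => _ _; apply.
  have sU : is_submod U.
    apply: is_submodP => [|x y Ux Uy|a x Ra [N FN Nx]].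
    - by apply: JU; apply: submod0; exact: (proj1 (proj1 tJ)).
    - have [|N [FN [tN _ _] Ns]] := sup [:: x; y].
        by move=> g; rewrite !inE => /orP[]/eqP->.
      exists N => //; apply: (submodD (A := N)); first exact: (proj1 (t_ideal_closed tN)).
        by apply: Ns; rewrite !inE eqxx.
      by apply: Ns; rewrite !inE eqxx orbT.
    - exists N => //; have [tN _ _] := Fx _ _ FN Nx.
      by apply: submodM => //; exact: (proj1 (t_ideal_closed tN)).
  split=> //; last by move=> [N FN N1]; have [_ pN _] := Fx _ _ FN N1.
  apply: t_closed_ideal.
  - split=> // x /(tclosP _ sU)[s [Us ns sx]].
    have [N [FN [tN _ _] Ns]] := sup _ Us; exists N => //.
    have [sN NN] := t_ideal_closed tN.
    by apply/NN/tclosP => //; exists s.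
  - by case: tJ => _ [[z [Jz nz_z]] _]; exists z; split=> //; apply: JU.
  - by move=> x [N FN Nx]; have [[[_ NR] _] _ _] := Fx _ _ FN Nx; apply: NR.
have gJ : good J by split.
have [tM pM JM] : good M.
  case: gM => // M0; exfalso; apply: (maxM J); last by right.
  by rewrite M0; split=> [x []|J0]; apply: (J0 0 (submod0 (proj1 (proj1 tJ)))).
exists M => //; split=> //; split=> // N tN pN MN.
apply: contrapT => NM; apply: (maxM N); last first.
  by right; split=> // x /JM /MN.
by split.
Qed.

(** For [a] outside [M], the multipliers of [a] into [M] form a proper t-ideal containing [M], hence
    equal to [M]. *)
Lemma t_maximal_prime M : t_maximal M -> prime_ideal M.
Proof.
move=> [tM [pM maxM]]; case: (tM) => -[sM MR] [nM _].
split=> //; split=> // a b Ra Rb Mab.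
have [Ma|nMa] := EM (M a); [by left|right].
have MC x : M x -> Rsub x /\ M (x * a).
  by move=> Mx; split; [apply: MR|rewrite mulrC; apply: submodM].
suff: Rsub b /\ M (b * a) -> M b by rewrite mulrC; apply.
apply: (maxM (fun r => Rsub r /\ M (r * a))) => //; last by rewrite /proper mul1r => -[].
apply: t_closed_ideal; last by move=> ? [].
  by apply: multiplier_t_closed; apply: t_ideal_closed.
by case: nM => z [Mz nz]; exists z; split=> //; apply: MC.
Qed.

Definition outside P x := Rsub x /\ ~ P x.

(** The elements of [R] multiplying [x] into [J] form a t-ideal contained in no t-maximal ideal, so
    [1] is among them. *)
Lemma local_global J x : t_closed J -> nonzeroK J ->
  (forall M, t_maximal M -> exists2 s, outside M s & J (s * x)) -> J x.
Proof.
move=> tJ [z [Jz nz_z]] locJ; case: (tJ) => sJ _.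
suff: Rsub (1 : K) /\ J (1 * x) by rewrite mul1r => -[].
apply: contrapT => pC.
have [M tM CM] : exists2 M, t_maximal M &
    subsetK (fun r : K => Rsub r /\ J (r * x)) M.
  apply: t_ideal_in_t_maximal => //; apply: t_closed_ideal; last by move=> ? [].
    exact: multiplier_t_closed.
  have [d nz_d Rd] := fraction_denominator (x / z).
  exists (emb d); rewrite emb_neq0; split=> //; split; first by exists d.
  by rewrite -(divfK nz_z x) mulrA; apply: submodM.
by have [s [Rs nMs] Js] := locJ _ tM; apply: nMs; apply: CM.
Qed.

End Ideals.

(** * Primes at which the localization is a valuation domain *)

Section Valuations.
Context (R : idomainType).
Local Notation K := {fraction R}.
Implicit Types (I J M N P Q A B : K -> Prop) (x y z : K).

Lemma prime_submod P : prime_ideal P -> is_submod P.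
Proof. by case=> -[]. Qed.

Lemma prime_sub P x : prime_ideal P -> P x -> Rsub x.
Proof. by case=> -[_ PR] _; apply: PR. Qed.

Lemma primeM P a b : prime_ideal P -> Rsub a -> Rsub b -> P (a * b) -> P a \/ P b.
Proof. by case=> _ [_]; apply. Qed.

Lemma primeX P a n : prime_ideal P -> Rsub a -> P (a ^+ n) -> P a.
Proof.
move=> pP Ra; elim: n => [P1|n IHn].
  by case: pP => _ [+ _] => /(_ P1).
by rewrite exprS => /(primeM pP Ra (RsubX n Ra)) [].
Qed.

Lemma outside1 P : prime_ideal P -> outside P 1.
Proof. by case=> _ [p1 _]; split=> //; apply: Rsub1. Qed.

Lemma outsideM P x y : prime_ideal P -> outside P x -> outside P y ->
  outside P (x * y).
Proof.
move=> pP [Rx nPx] [Ry nPy]; split; first exact: RsubM.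
by move=> /(primeM pP Rx Ry) [].
Qed.

Lemma outsideX P x n : prime_ideal P -> outside P x -> outside P (x ^+ n).
Proof.
move=> pP ox; elim: n => [|n IHn]; first exact: outside1.
by rewrite exprS; apply: outsideM.
Qed.

Lemma outside_neq0 P x : prime_ideal P -> outside P x -> x != 0.
Proof.
move=> pP [_ nPx]; apply/eqP => x0; apply: nPx; rewrite x0.
exact: submod0 (prime_submod pP).
Qed.

Lemma outside_sub P Q x : subsetK P Q -> outside Q x -> outside P x.
Proof. by move=> PQ [Rx nQx]; split=> // /PQ. Qed.

Lemma locP P x : prime_ideal P ->
  loc P x <-> exists2 s, outside P s & Rsub (s * x).
Proof.
move=> pP; split=> [[a [s [Ra [Rs [nPs ->]]]]]|[s os Rsx]].
  by exists s => //; rewrite mulrC divfK // (outside_neq0 pP (conj Rs nPs)).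
exists (s * x), s; case: (os) => Rs nPs; do !split=> //.
by rewrite mulrAC divff ?mul1r // (outside_neq0 pP os).
Qed.

Lemma loc_sub P Q : prime_ideal P -> prime_ideal Q -> subsetK P Q ->
  subsetK (loc Q) (loc P).
Proof.
move=> pP pQ PQ x /(locP _ pQ)[s os Rsx]; apply/(locP _ pP).
by exists s => //; apply: outside_sub os.
Qed.

Lemma locM P x y : prime_ideal P -> loc P x -> loc P y -> loc P (x * y).
Proof.
move=> pP /(locP _ pP)[s os Rsx] /(locP _ pP)[t ot Rty]; apply/(locP _ pP).
by exists (s * t); [apply: outsideM|rewrite mulrACA; apply: RsubM].
Qed.

Lemma Rsub_loc P x : prime_ideal P -> Rsub x -> loc P x.
Proof.
by move=> pP Rx; apply/(locP _ pP); exists 1; [apply: outside1|rewrite mul1r].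
Qed.

Lemma localized_submod P A : prime_ideal P -> is_submod A ->
  is_submod (fun x => exists2 s, outside P s & A (s * x)).
Proof.
move=> pP sA; apply: is_submodP => [|x y [s os As] [t ot At]|a x Ra [s os As]].
- by exists 1; [apply: outside1|rewrite mulr0; apply: submod0].
- exists (s * t); first exact: outsideM.
  rewrite (_ : _ * _ = t * (s * x) + s * (t * y)); last by ring.
  by apply: submodD => //; apply: submodM => //; [case: ot|case: os].
- by exists s => //; rewrite mulrCA; apply: submodM.
Qed.

Lemma loc_submod P : prime_ideal P -> is_submod (loc P).
Proof.
move=> pP; rewrite (_ : loc P = fun x => exists2 s, outside P s & Rsub (s * x)).
  exact: localized_submod pP (Rsub_submod R).
by apply/predeqP => x; apply: locP.
Qed.

Definition valued_prime P := prime_ideal P /\ valuation (loc P).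

Lemma valued_prime_sub P Q : prime_ideal P -> valued_prime Q -> subsetK P Q ->
  valued_prime P.
Proof.
move=> pP [pQ vQ] PQ; split=> // x /vQ[] /(loc_sub pP pQ PQ); by [left|right].
Qed.

(** The inverse of [x] lies in the maximal ideal of [loc P]; it is written as [c / d]. *)
Lemma not_locP P x : valued_prime P -> ~ loc P x ->
  exists c d, [/\ P c, outside P d & x * c = d].
Proof.
move=> [pP vP] nlx; have x0 : x != 0.
  by apply/eqP => x0; apply: nlx; rewrite x0; apply: Rsub_loc => //; apply: Rsub0.
have [//|/(locP _ pP)[d od Rdx]] := vP _ x0.
have xd : x * (d * x^-1) = d by rewrite mulrC divfK.
exists (d * x^-1), d; split=> //; apply: contrapT => nP; apply: nlx.
by apply/(locP _ pP); exists (d * x^-1); [split|rewrite mulrC xd; case: od].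
Qed.

(* The maximal ideals of [loc P] and [loc M] coincide when [P] is contained in
   [M]: a fraction [p / v] with [p] in [P], [v] outside [P] is also [c / t] with
   [c] in [P] and [t] outside the larger prime [M]. *)
Lemma change_denominator P M p v : prime_ideal P -> valued_prime M ->
  subsetK P M -> P p -> outside P v ->
  exists t c, [/\ outside M t, P c & t * p = c * v].
Proof.
move=> pP vM PM Pp ov; have [pM _] := vM.
have v0 : v != 0 := outside_neq0 pP ov.
have [/(locP _ pM)[t ot Rt]|] := EM (loc M (p / v)).
  have e : t * p = t * (p / v) * v by rewrite -mulrA divfK.
  exists t, (t * (p / v)); split=> //.
  have := submodM (prime_submod pP) (proj1 ot) Pp.
  by rewrite e => /(primeM pP Rt (proj1 ov)) [] // /(proj2 ov).
move=> /(not_locP vM)[c [d [Mc od e]]]; exfalso.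
have e' : c * p = d * v by rewrite -e mulrAC divfK // mulrC.
have : P (d * v) by rewrite -e'; apply: submodM (prime_submod pP) (prime_sub pM Mc) Pp.
have := outside_sub PM od => od'.
by apply: (proj2 (outsideM pP od' ov)).
Qed.

(** Finitely generated modules over a valuation domain are principal, generated by a member of the
    given list; [t] is a common denominator for the quotients by that member. *)
Lemma seq_dominated P (s : seq K) : valued_prime P ->
  (forall g, g \in s -> g = 0) \/
  exists f t, [/\ f \in s, f != 0, outside P t &
    forall g, g \in s -> Rsub (t * g / f)].
Proof.
move=> [pP vP]; elim: s => [|g s [s0|[f [t [fs nz_f ot st]]]]]; first by left.
  have [g0|nz_g] := eqVneq g 0; [left|right].
    by move=> h; rewrite inE => /orP[/eqP->//|/s0].
  exists g, 1; split=> //; [exact: mem_head|exact: outside1|].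
  move=> h; rewrite inE mul1r => /orP[/eqP->|/s0->].
    by rewrite divff //; apply: Rsub1.
  by rewrite mul0r; apply: Rsub0.
right; have [->|nz_g] := eqVneq g 0.
  exists f, t; split=> // [|h]; first by rewrite inE fs orbT.
  by rewrite inE => /orP[/eqP->|/st//]; rewrite mulr0 mul0r; apply: Rsub0.
have [||] := vP (g / f); first by rewrite mulf_neq0 ?invr_eq0.
  move=> /(locP _ pP)[u ou Ru]; exists f, (t * u); split=> //.
  - by rewrite inE fs orbT.
  - exact: outsideM.
  - move=> h; rewrite inE => /orP[/eqP->|hs].
      by rewrite -!mulrA; apply: RsubM => //; case: ot.
    rewrite (_ : _ / f = u * (t * h / f)); last by ring.
    by apply: RsubM; [case: ou|apply: st].
move=> /(locP _ pP)[u ou Ru]; exists g, (t * u); split=> //.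
- exact: mem_head.
- exact: outsideM.
- move=> h; rewrite inE => /orP[/eqP->|hs].
    by rewrite mulfK //; apply: RsubM; [case: ot|case: ou].
  rewrite (_ : _ / g = (t * h / f) * (u * (g / f)^-1)); last first.
    by rewrite invf_div [u * _]mulrCA [RHS]mulrA divfK //; ring.
  by apply: RsubM => //; apply: st.
Qed.

(** The t-closure adds nothing over [loc P]: if [f] generates the list locally, then [t / f]
    multiplies the whole list into [R], hence [x] too. *)
Lemma tclos_loc P I x : valued_prime P -> is_submod I -> tclos I x ->
  exists2 s, outside P s & I (s * x).
Proof.
move=> vP sI /(tclosP _ sI)[s [Is [g gs nz_g] sx]].
have [s0|[f [t [fs nz_f ot st]]]] := seq_dominated s vP.
  by rewrite (s0 _ gs) eqxx in nz_g.
exists t => //; rewrite (_ : t * x = x * (t / f) * f); last first.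
  by rewrite -!mulrA mulVf // mulr1 mulrC.
apply: submodM => //; last exact: Is.
by apply: sx => h /st; rewrite mulrAC.
Qed.

Lemma valued_prime_t_prime P : valued_prime P -> nonzeroK P -> t_prime P.
Proof.
move=> vP nP; have [pP _] := vP; split=> //.
apply: t_closed_ideal => //; last by move=> x; apply: prime_sub.
split=> [|x tx]; first exact: prime_submod.
have Rx : Rsub x.
  by apply: (proj2 (Rsub_t_closed R)); apply: tclos_mono tx => z; apply: prime_sub.
have [s [Rs nPs] Psx] := tclos_loc vP (prime_submod pP) tx.
by case: (primeM pP Rs Rx Psx).
Qed.

(** Given [p] in [P] but not in [Q], and [q] in [Q] but not in [P], [change_denominator] writes
    [t * p] as a multiple of [q], forcing a product of elements outside [Q] into [Q]. *)
Lemma valued_primes_comparable P Q M : valued_prime M -> prime_ideal P ->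
  prime_ideal Q -> subsetK P M -> subsetK Q M -> subsetK P Q \/ subsetK Q P.
Proof.
move=> vM pP pQ PM QM.
have [PQ|/not_subsetK[p [Pp nQp]]] := EM (subsetK P Q); [by left|right].
move=> q Qq; apply: contrapT => nPq.
have oq : outside P q by split=> //; apply: prime_sub Qq.
have [t [c [ot Pc e]]] := change_denominator pP vM PM Pp oq.
have: Q (t * p).
  by rewrite e; apply: submodM => //; [apply: prime_submod|apply: prime_sub Pc].
have op : outside Q p by split=> //; apply: prime_sub Pp.
exact: (proj2 (outsideM pQ (outside_sub QM ot) op)).
Qed.

(** * Contractions to [R] of radicals taken in [loc M] *)

Definition local_radical J M x :=
  Rsub x /\ exists n s, outside M s /\ J (s * x ^+ n).

(** In a valuation domain one of [x], [y] divides the other, so the square of one of them is a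
    multiple of [x * y]; a radical ideal containing the product then contains that factor. *)
Lemma local_radical_prime J M : is_submod J -> subsetK J M -> valued_prime M ->
  prime_ideal (local_radical J M).
Proof.
move=> sJ JM [pM vM]; set P := local_radical J M.
have P_dvd u w x y : outside M u -> Rsub w -> Rsub y -> u * y = x * w -> P x -> P y.
  move=> ou Rw Ry e [Rx [n [s [os Js]]]]; split=> //.
  exists n, (u ^+ n * s); split; first by apply: outsideM => //; apply: outsideX.
  rewrite (_ : _ * _ = w ^+ n * (s * x ^+ n)); first by apply: submodM => //; apply: RsubX.
  by rewrite -mulrA mulrCA -exprMn e exprMn; ring.
have comp x y : exists u w, [/\ outside M u, Rsub w & u * x = y * w \/ u * y = x * w].
  have [->|nz_x] := eqVneq x 0.
    by exists 1, 0; split; [apply: outside1|apply: Rsub0|rewrite !mulr0; left].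
  have [->|nz_y] := eqVneq y 0.
    by exists 1, 0; split; [apply: outside1|apply: Rsub0|rewrite !mulr0; right].
  have [||] := vM (x / y); first by rewrite mulf_neq0 ?invr_eq0.
    move=> /(locP _ pM)[u ou Ru]; exists u, (u * (x / y)); split=> //; left.
    by rewrite mulrCA (mulrC y) divfK.
  move=> /(locP _ pM)[u ou Ru]; exists u, (u * (x / y)^-1); split=> //; right.
  by rewrite invf_div mulrCA (mulrC x) divfK.
have PR x : P x -> Rsub x by case.
split; last split.
- split; last by [].
  apply: is_submodP => [|x y Px Py|a x Ra Px].
  + split; first exact: Rsub0.
    by exists 1%N, 1; split; [apply: outside1|rewrite mulr0; apply: submod0].
  + have [u [w [ou Rw [e|e]]]] := comp x y.
      apply: (P_dvd u (w + u) y) => //; first by apply: RsubD => //; case: ou.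
        by apply: RsubD; apply: PR.
      by rewrite mulrDr e; ring.
    apply: (P_dvd u (w + u) x) => //; first by apply: RsubD => //; case: ou.
      by apply: RsubD; apply: PR.
    by rewrite mulrDr e; ring.
  + apply: (P_dvd 1 a x) => //; [exact: outside1|by apply: RsubM => //; apply: PR|].
    by rewrite mul1r mulrC.
- move=> [_ [n [s [[Rs nMs] Js]]]]; apply: nMs; apply: JM.
  by rewrite expr1n mulr1 in Js.
- move=> x y Rx Ry Pxy.
  have sqr z : Rsub z -> P (z ^+ 2) -> P z.
    move=> Rz [_ [n [s [os Js]]]]; split=> //; exists (2 * n)%N, s.
    by rewrite exprM.
  have [u [w [ou Rw [e|e]]]] := comp x y; [left|right]; apply: sqr => //.
    apply: (P_dvd u w (x * y)) => //; first exact: RsubX.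
    by rewrite expr2 mulrA e; ring.
  apply: (P_dvd u w (x * y)) => //; first exact: RsubX.
  by rewrite expr2 mulrA e; ring.
Qed.

Lemma local_radical_sub J M : subsetK J M -> prime_ideal M ->
  subsetK (local_radical J M) M.
Proof.
move=> JM pM x [Rx [n [s [[Rs nMs] /JM]]]].
by move=> /(primeM pM Rs (RsubX n Rx)) [] // /(primeX pM Rx).
Qed.

Lemma sub_local_radical J M : prime_ideal M -> subsetK J (@Rsub R) ->
  subsetK J (local_radical J M).
Proof.
move=> pM JR x Jx; split; first exact: JR.
by exists 1%N, 1; split; [apply: outside1|rewrite mul1r].
Qed.

Lemma PvMD_t_maximal M : PvMD R -> t_maximal M -> valued_prime M.
Proof. by move=> pv tM; split; [apply: t_maximal_prime|apply: pv]. Qed.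

Lemma PvMD_t_prime P : PvMD R -> t_prime P -> valued_prime P.
Proof.
move=> pv [pP tP]; have [M tM PM] := t_ideal_in_t_maximal tP (proj1 (proj2 pP)).
exact: valued_prime_sub (PvMD_t_maximal pv tM) PM.
Qed.

End Valuations.

(** * From t-finite character to the t##-property, and sharp primes *)

Section SharpPrimes.
Context (R : idomainType).
Local Notation K := {fraction R}.
Implicit Types (I J M N P Q A B : K -> Prop) (x y z : K).

Lemma t_maximal_t_prime M : t_maximal M -> t_prime M.
Proof. by move=> tM; split; [apply: t_maximal_prime|case: tM]. Qed.

Lemma finite_character_dominated (F1 F2 : (K -> Prop) -> Prop) P :
  PvMD R -> t_finite_character R -> t_prime P ->
  pairwise_incomparable_t_primes F2 -> subsetK (bigcap_loc F2) (loc P) ->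
  exists2 Q, F2 Q & subsetK P Q.
Proof.
move=> pv fc tP [tF2 incF2] cap; apply: contrapT => no.
have {}no Q : F2 Q -> exists x, P x /\ ~ Q x.
  by move=> FQ; apply: not_subsetK => PQ; apply: no; exists Q.
have vP := PvMD_t_prime pv tP; have [pP _] := vP.
have [_ [_ [[z [Pz nz_z]] _]]] := tP.
have [r zr] := prime_sub pP Pz.
have [|n [f fr]] := fc r; first by rewrite -emb_neq0 -zr.
(* Members of [F2] below the same [f i] are comparable, hence equal, so one element of [P] serves
   for each [i]. The clause asks for [t_maximal (f i)] because the enumeration may contain other
   predicates. *)
have [s [sP sf]] : exists s : seq K, (forall g, g \in s -> P g) /\
    forall i Q, (i < n)%N -> F2 Q -> t_maximal (f i) -> subsetK Q (f i) ->
      exists2 g, g \in s & ~ Q g.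
  elim: n {fr} => [|n [s [sP sf]]]; first by exists [::].
  have [[Q0 [FQ0 tf Qf]]|noQ] := EM (exists Q, [/\ F2 Q, t_maximal (f n) & subsetK Q (f n)]).
    have [g [Pg nQg]] := no _ FQ0; exists (g :: s); split.
      by move=> h; rewrite inE => /orP[/eqP->|/sP].
    move=> i Q; rewrite ltnS leq_eqVlt => /orP[/eqP->|lt_in] FQ tfi Qfi; last first.
      by have [h hs nQh] := sf _ _ lt_in FQ tfi Qfi; exists h; rewrite ?inE ?hs ?orbT.
    exists g; first exact: mem_head.
    have [pQ _] := tF2 _ FQ; have [pQ0 _] := tF2 _ FQ0.
    suff -> : Q = Q0 by [].
    have [] := valued_primes_comparable (PvMD_t_maximal pv tf) pQ pQ0 Qfi Qf.
      exact: incF2.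
    by move=> Q0Q; apply/esym/incF2.
  exists s; split=> // i Q; rewrite ltnS leq_eqVlt => /orP[/eqP->|]; last exact: sf.
  by move=> FQ tf Qf; case: noQ; exists Q.
(* If the t-maximal ideal above [Q] omits [z], then so does [Q]; otherwise that ideal is one of the
   [f i]. *)
have s_escapes Q : F2 Q -> exists2 g, g \in z :: s & ~ Q g.
  move=> FQ; have [pQ tQ] := tF2 _ FQ.
  have [N tN QN] := t_ideal_in_t_maximal tQ (proj1 (proj2 pQ)).
  have [Nz|nNz] := EM (N z); last by exists z; [exact: mem_head|move=> /QN].
  rewrite zr in Nz; have [i [lt_in /predeqP Nf]] := fr _ tN Nz.
  rewrite Nf in tN QN; have [g gs nQg] := sf _ _ lt_in FQ tN QN.
  by exists g; rewrite // inE gs orbT.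
have [zs0|[g [t [gs nz_g ot gzs]]]] := seq_dominated (z :: s) vP.
  by rewrite (zs0 _ (mem_head _ _)) eqxx in nz_z.
have zsP h : h \in z :: s -> P h by rewrite inE => /orP[/eqP->|/sP].
(* [t / g] multiplies all of [z :: s] into [R], and each [Q] omits one of these elements, which
   serves as denominator. *)
have /(locP _ pP)[u [Ru nPu] Rutg] : loc P (t / g).
  apply: cap => Q FQ; have [pQ _] := tF2 _ FQ.
  have [h hs nQh] := s_escapes Q FQ; apply/(locP _ pQ); exists h.
    by split=> //; apply: prime_sub pP _; apply: zsP.
  by rewrite mulrCA mulrA; apply: gzs.
apply: (proj2 (outsideM pP (conj Ru nPu) ot)).
rewrite (_ : u * t = u * (t / g) * g); last by rewrite -!mulrA mulVf // mulr1.
by apply: submodM (prime_submod pP) Rutg _; apply: zsP.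
Qed.

(** Domination used in both directions puts [P] inside some [Q] of the other set and [Q] inside some
    [P'] of the first; incomparability makes all three equal. *)
Lemma finite_character_sharpsharp : PvMD R -> t_finite_character R ->
  t_sharpsharp R.
Proof.
move=> pv fc F1 F2 iF1 iF2 neF capE; apply: neF.
have sub (F G : (K -> Prop) -> Prop) : pairwise_incomparable_t_primes F ->
    pairwise_incomparable_t_primes G -> bigcap_loc F = bigcap_loc G ->
    forall P, F P -> G P.
  move=> iF iG e P FP; have [tF incF] := iF; have [tG _] := iG.
  have [Q GQ PQ] : exists2 Q, G Q & subsetK P Q.
    apply: finite_character_dominated => //; first exact: tF.
    by rewrite -e => x; apply.
  have [P' FP' QP'] : exists2 P', F P' & subsetK Q P'.
    apply: finite_character_dominated => //; first exact: tG.
    by rewrite e => x; apply.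
  have PP' : P = P' by apply: incF => // x /PQ /QP'.
  by rewrite (subsetK_antisym PQ) // PP'.
by apply/predeqP => P; split; apply: sub.
Qed.

(* For a PvMD this is the usual sharpness of [P]: the ideal [R : (1, x)] is
   [v]-finite, contained in [P], and every t-maximal ideal over it contains [P]. *)
Definition sharp P := exists x, ~ loc P x /\
  forall N, t_maximal N -> ~ subsetK P N -> loc N x.

Lemma sharpsharp_sharp P : t_sharpsharp R -> t_prime P -> sharp P.
Proof.
move=> ss tP; pose F N := t_maximal N /\ ~ subsetK P N.
have incF : pairwise_incomparable_t_primes F.
  split=> [N [tN _]|N N' [tN _] [tN' _]]; first exact: t_maximal_t_prime.
  exact: t_maximal_eq.
have incPF : pairwise_incomparable_t_primes (fun N => N = P \/ F N).
  split=> [N [->//|[tN _]]|N N' [->|[tN nPN]] [->|[tN' nPN']] //].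
  - exact: t_maximal_t_prime.
  - move=> NP; case: nPN; case: tN => tN [pN maxN].
    by case: tP => -[_ [pP _]] tP; apply: maxN.
  - exact: t_maximal_eq.
have neF : (fun N => N = P \/ F N) <> F.
  by move=> /predeqP/(_ P)[+ _] => -[|_]; [left|apply].
have [x [Fx nPx]] : exists x, bigcap_loc F x /\ ~ loc P x.
  apply: not_subsetK => cap; apply: (ss _ _ incPF incF neF).
  apply: subsetK_antisym => x Fx N FN; first by apply: Fx; right.
  by case: FN => [->|FN]; [apply: cap|apply: Fx].
by exists x; split=> // N tN nPN; apply: Fx.
Qed.

(** * Products of submodules and trace ideals *)

Lemma prodK_submod A B : is_submod A -> is_submod (prodK A B).
Proof.
move=> sA; apply: is_submodP => [|x y [l [lAB ->]] [k [kAB ->]]|a x Ra [l [lAB ->]]].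
- by exists [::]; rewrite big_nil.
- exists (l ++ k); split; last by rewrite big_cat.
  by move=> p; rewrite mem_cat => /orP[/lAB|/kAB].
- exists [seq (a * p.1, p.2) | p <- l]; split.
    by move=> _ /mapP[p /lAB[Ap Bp] ->]; split=> //; apply: submodM.
  by rewrite big_map mulr_sumr; apply: eq_bigr => p _; rewrite mulrA.
Qed.

Lemma prodK_mul A B a b : A a -> B b -> prodK A B (a * b).
Proof.
move=> Aa Bb; exists [:: (a, b)]; rewrite big_seq1; split=> // p.
by rewrite inE => /eqP->.
Qed.

Lemma prodK_sub A B C : is_submod C -> (forall a b, A a -> B b -> C (a * b)) ->
  subsetK (prodK A B) C.
Proof.
move=> sC ABC x [l [lAB ->]]; rewrite big_seq; apply: (big_ind C).
- exact: submod0.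
- by move=> u v; apply: submodD.
- by move=> p /lAB[]; apply: ABC.
Qed.

Definition trace I := prodK I (colon (@Rsub R) I).

Lemma sub_trace I : ideal I -> subsetK I (trace I).
Proof.
by move=> [_ IR] x Ix; rewrite -[x]mulr1; apply: prodK_mul => // b /IR; rewrite mul1r.
Qed.

Lemma trace_sub I : subsetK (trace I) (@Rsub R).
Proof.
apply: prodK_sub; first exact: Rsub_submod.
by move=> a b Ia; rewrite mulrC; apply.
Qed.

Lemma trace_nonzero I : ideal I -> nonzeroK I -> nonzeroK (trace I).
Proof. by move=> iI [z [Iz nz_z]]; exists z; split=> //; apply: sub_trace. Qed.

End SharpPrimes.

(** * The trace of an ideal, studied at a t-maximal ideal above it *)

Section Trace.
Context (R : idomainType) (I M : {fraction R} -> Prop).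
Local Notation K := {fraction R}.
Implicit Types (N Q : K -> Prop) (x y z : K).
Context (pv : PvMD R) (iI : ideal I) (nI : nonzeroK I) (tM : t_maximal M).
Let J := tclos (trace I).
Context (JM : subsetK J M).
Let P := local_radical J M.

Let vM : valued_prime M. Proof. exact: PvMD_t_maximal. Qed.
Let pM : prime_ideal M. Proof. by case: vM. Qed.
Let sI : is_submod I. Proof. by case: iI. Qed.
Let sT : is_submod (trace I). Proof. exact: prodK_submod. Qed.
Let nT : nonzeroK (trace I). Proof. exact: trace_nonzero. Qed.
Let sJ : is_submod J. Proof. exact: tclos_submod. Qed.
Let TJ : subsetK (trace I) J. Proof. exact: sub_tclos. Qed.

Let JR : subsetK J (@Rsub R).
Proof.
by move=> x Jx; apply: (proj2 (Rsub_t_closed R)); apply: tclos_mono Jx; apply: trace_sub.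
Qed.

Let pP : prime_ideal P. Proof. exact: local_radical_prime. Qed.
Let PM : subsetK P M. Proof. exact: local_radical_sub. Qed.
Let vP : valued_prime P. Proof. exact: valued_prime_sub vM PM. Qed.

Lemma trace_radical_t_prime : t_prime P.
Proof.
apply: valued_prime_t_prime => //; have [z [Tz nz_z]] := nT.
by exists z; split=> //; apply: sub_local_radical => //; apply: TJ.
Qed.

Let out_PM s : outside M s -> outside P s. Proof. exact: outside_sub. Qed.

Context (shP : sharp P).

Lemma colon_local y b : (forall i, I i -> loc P (y * i)) -> P b ->
  exists2 t, outside M t & colon (@Rsub R) I (t * b * y).
Proof.
move=> yI Pb; have [x [nPx xN]] := shP.
have [c [d [Pc od xc]]] := not_locP vP nPx.
have [Rc [n [e [oe Je]]]] := Pc.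
(* Multiplication by a trace element sends [y] to sums of terms [(y * i) * k], with [y * i] in
   [loc P] and [k] in the colon; [e * c ^+ n] is such an element up to a factor outside [P]. *)
have [s os sk] : exists2 s, outside P s &
    colon (@Rsub R) I (s * (y * (e * c ^+ n))).
  have [v ov Tv] := tclos_loc vP sT Je.
  suff [s os sk] : exists2 s, outside P s &
      colon (@Rsub R) I (s * (y * (v * (e * c ^+ n)))).
    exists (s * v); first exact: outsideM.
    by rewrite (_ : _ * _ = s * (y * (v * (e * c ^+ n)))) //; ring.
  have sC := localized_submod pP (colon_submod I (Rsub_submod R)).
  move: (v * _) Tv; apply: prodK_sub.
    apply: is_submodP => [|z w|a z].
    - by rewrite mulr0; apply: submod0 sC.
    - by rewrite mulrDr; apply: submodD sC.
    - by rewrite mulrCA; apply: submodM sC.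
  move=> i k Ii kI; have /(locP _ pP)[s os Rs] := yI i Ii; exists s => //.
  rewrite (_ : s * _ = s * (y * i) * k); last by ring.
  exact: submodM (colon_submod I (Rsub_submod R)) Rs kI.
set k := s * _ in sk.
(* The factor [d ^+ n] equals [x ^+ n * c ^+ n]; this makes [t * b * y] a multiple of [x ^+ n * k],
   where [k] is already in the colon. *)
have osd : outside P (d ^+ n * s * e).
  exact: outsideM pP (outsideM pP (outsideX n pP od) os) (out_PM oe).
have [t [b' [ot Pb' tb]]] := change_denominator pP vM PM Pb osd.
have tby : t * b * y = b' * x ^+ n * k by rewrite tb -xc exprMn /k; ring.
exists t => // i Ii; apply: local_global; first exact: Rsub_t_closed.
  by exists 1; split; [apply: Rsub1|apply: oner_neq0].
(* Above [P], the factor [t * b] in [P] absorbs any denominator outside [P]. Elsewhere [x] lies in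
   [loc N], so only the denominator of [x ^+ n] has to be cleared. *)
move=> N tN; have [PN|nPN] := EM (subsetK P N).
  have /(locP _ pP)[v ov Rv] := yI i Ii.
  have vN := PvMD_t_maximal pv tN.
  have Ptb : P (t * b) by apply: submodM (prime_submod pP) (proj1 ot) Pb.
  have [u [c' [ou Pc' uc]]] := change_denominator pP vN PN Ptb ov.
  exists u => //; rewrite (_ : u * _ = u * (t * b) * (y * i)); last by ring.
  by rewrite uc -mulrA; apply: RsubM => //; apply: prime_sub pP Pc'.
have pN := t_maximal_prime tN.
have /(locP _ pN)[u ou Rux] := xN N tN nPN.
exists (u ^+ n); first exact: outsideX.
rewrite tby (_ : _ * _ = b' * (u * x) ^+ n * (k * i)); last by rewrite exprMn; ring.
by apply: RsubM; [apply: RsubM; [apply: prime_sub pP Pb'|apply: RsubX]|apply: sk].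
Qed.

Lemma trace_local y b i : (forall j, I j -> loc P (y * j)) -> P b -> I i ->
  exists2 t, outside M t & J (t * (b * y * i)).
Proof.
move=> yI Pb Ii; have [t ot tbI] := colon_local yI Pb; exists t => //.
rewrite (_ : _ * _ = i * (t * b * y)); last by ring.
by apply: TJ; apply: prodK_mul.
Qed.

(** Otherwise [I] lies in [a ^+ n * I] over [loc P] for every [n], so the trace lies in every power
    of [a]. But the trace contains some [a ^+ n] up to a factor outside [P], which would make [a] a
    unit of [loc P]. *)
Lemma not_divisible a : P a -> a != 0 ->
  ~ forall i, I i -> i != 0 -> exists j, [/\ I j, j != 0 & loc P (i / (a * j))].
Proof.
move=> Pa nz_a divI.
have {}divI n i : I i -> i != 0 ->
    exists j, [/\ I j, j != 0 & loc P (i / (a ^+ n * j))].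
  move=> Ii nz_i; elim: n => [|n [j [Ij nz_j lj]]].
    exists i; split=> //; rewrite mul1r divff //.
    by apply: Rsub_loc => //; apply: Rsub1.
  have [k [Ik nz_k lk]] := divI j Ij nz_j; exists k; split=> //.
  rewrite (_ : i / _ = (i / (a ^+ n * j)) * (j / (a * k))); first exact: locM.
  rewrite mulf_div (_ : _ * (a * k) = a ^+ n.+1 * k * j); last first.
    by rewrite exprSr; ring.
  by rewrite -mulf_div divff // mulr1.
have [Ra [n [s [os Js]]]] := Pa.
have [v ov Tv] := tclos_loc vP sT Js.
have : loc P (v * (s * a ^+ n) / a ^+ n.+1).
  have sL := loc_submod pP.
  move: (v * _) Tv; apply: prodK_sub.
    apply: is_submodP => [|z w|b z].
    - by rewrite mul0r; apply: submod0 sL.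
    - by rewrite mulrDl; apply: submodD sL.
    - by rewrite -mulrA; apply: submodM sL.
  move=> i k Ii kI; have [->|nz_i] := eqVneq i 0.
    by rewrite !mul0r; apply: submod0 sL.
  have [j [Ij nz_j lj]] := divI n.+1 i Ii nz_i.
  rewrite (_ : _ / _ = (i / (a ^+ n.+1 * j)) * (k * j)).
    by apply: locM => //; apply: Rsub_loc => //; apply: kI.
  by rewrite invfM [i * (_ * _)]mulrA mulrACA mulVf // mulr1 mulrAC.
rewrite (_ : _ / _ = v * s / a); last first.
  by rewrite exprS mulrA -mulf_div divff ?expf_neq0 // mulr1.
move=> /(locP _ pP)[u ou Ru]; have ovs := outsideM pP ov (out_PM os).
apply: (proj2 (outsideM pP ou ovs)).
rewrite (_ : _ * _ = u * (v * s / a) * a); last by rewrite -[RHS]mulrA divfK.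
exact: submodM (prime_submod pP) Ru Pa.
Qed.

Lemma loc_total x y : x != 0 -> y != 0 -> loc P (x / y) \/ loc P (y / x).
Proof.
move=> nz_x nz_y; have := proj2 vP (x / y); rewrite invf_div; apply.
by rewrite mulf_neq0 ?invr_eq0.
Qed.

(* If [a] does not generate [P] over [loc P], write [a] as a product [p * w] in
   [P * P] and use [w] to bound [I] by one of its elements; if it does, [I] is
   principal over [loc P]. *)
Lemma local_radical_trace a : P a -> exists2 t, outside M t & J (t * a).
Proof.
move=> Pa; have [->|nz_a] := eqVneq a 0.
  by exists 1; [apply: outside1|rewrite mulr0; apply: submod0].
have [[p [Pp nlp]]|genP] := EM (exists p, P p /\ ~ loc P (p / a)).
  have [w [v [Pw ov pw]]] := not_locP vP nlp.
  have {pw} vw : v * a = p * w by rewrite -pw mulrAC divfK.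
  have nz_p : p != 0.
    by apply/eqP => p0; apply: nlp; rewrite p0 mul0r; apply: submod0 (loc_submod pP).
  have nz_w : w != 0.
    apply/eqP => w0; have /eqP := vw.
    by rewrite w0 mulr0 mulf_eq0 (negbTE nz_a) (negbTE (outside_neq0 pP ov)).
  (* By [not_divisible] some [i] is a local multiple of no [w * j]; in a valuation domain every
     [w * j] is then a local multiple of [i]. *)
  have [i [Ii nz_i iI']] : exists i, [/\ I i, i != 0 &
      forall j, I j -> loc P (w / i * j)].
    apply: contrapT => noi; apply: (not_divisible Pw nz_w) => i Ii nz_i.
    apply: contrapT => noj; apply: noi; exists i; split=> // j Ij.
    have [->|nz_j] := eqVneq j 0; first by rewrite mulr0; apply: submod0 (loc_submod pP).
    have [lj|] := loc_total nz_i (mulf_neq0 nz_w nz_j); last by rewrite mulrAC.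
    by case: noj; exists j.
  have [t [b [ot Pb tb]]] := change_denominator pP vM PM Pp ov.
  have [u ou Ju] := trace_local iI' Pb Ii.
  exists (u * t); first exact: outsideM.
  rewrite (_ : _ * a = u * (b * (w / i) * i)) //.
  apply: (mulIf (outside_neq0 pP ov)).
  rewrite (_ : _ * v = u * (t * (v * a))); last by ring.
  by rewrite vw [t * _]mulrA tb -(mulrA b (w / i)) divfK //; ring.
(* If [j / i] is not in [loc P], then [i / j] is in the maximal ideal, here generated by [a], so [i]
   is a local multiple of [a * j]; [not_divisible] excludes this for some [i]. *)
have [i [Ii nz_i iI']] : exists i, [/\ I i, i != 0 & forall j, I j -> loc P (i^-1 * j)].
  apply: contrapT => noi; apply: (not_divisible Pa nz_a) => i Ii nz_i.
  apply: contrapT => noj; apply: noi; exists i; split=> // j Ij; rewrite mulrC.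
  have [->|nz_j] := eqVneq j 0; first by rewrite mul0r; apply: submod0 (loc_submod pP).
  apply: contrapT => nl; apply: noj; exists j; split=> //.
  have [w [v [Pw ov jw]]] := not_locP vP nl.
  have lwa : loc P (w / a) by apply: contrapT => nlw; apply: genP; exists w.
  have nz_v := outside_neq0 pP ov.
  have nz_w : w != 0 by apply/eqP => w0; rewrite -jw w0 mulr0 eqxx in nz_v.
  rewrite (_ : i / _ = w / a * v^-1).
    apply: locM => //; apply/(locP _ pP); exists v => //.
    by rewrite divff //; apply: Rsub1.
  by rewrite -jw (invfM _ w) [_ / w]mulrC mulrACA divff // mul1r !invfM invrK mulrCA (mulrC i).
have [t ot Jt] := trace_local iI' Pa Ii; exists t => //.
by rewrite -mulrA mulVf // mulr1 in Jt.
Qed.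

End Trace.

(** * Radicality of the trace closure from the t##-property *)

Section MainImplications.
Context (R : idomainType).
Local Notation K := {fraction R}.
Implicit Types (I J M N P Q : K -> Prop) (x y z : K).

Lemma sharpsharp_tRTP : PvMD R -> t_sharpsharp R -> tRTP R.
Proof.
(* The radical alternative can always be chosen, since [R] itself is radical. *)
move=> pv ss I iI nI J; right=> x Rx n Jxn.
have sT : is_submod (trace I) by apply: prodK_submod; case: iI.
have nT := trace_nonzero iI nI.
apply: local_global; first exact: tclos_t_closed.
  by have [z [Tz nz_z]] := nT; exists z; split=> //; apply: sub_tclos.
move=> M tM; have [JM|/not_subsetK[s [Js nMs]]] := EM (subsetK J M); last first.
  exists s; last by rewrite mulrC; apply: submodM => //; apply: tclos_submod.
  split=> //; apply: (proj2 (Rsub_t_closed R)).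
  by apply: tclos_mono Js; apply: trace_sub.
apply: local_radical_trace => //.
  exact/(sharpsharp_sharp ss)/trace_radical_t_prime.
split=> //; exists n, 1; rewrite mul1r; split=> //.
exact/outside1/t_maximal_prime.
Qed.

(** * Return from the tRTP condition to t-finite character *)

Definition finitely_many (S : (K -> Prop) -> Prop) :=
  exists (n : nat) (f : nat -> K -> Prop),
    forall M, S M -> exists i, (i < n)%N /\ forall x, M x <-> f i x.

Lemma finitely_many_sub (S T : (K -> Prop) -> Prop) :
  (forall M, S M -> T M) -> finitely_many T -> finitely_many S.
Proof. by move=> ST [n [f Tf]]; exists n, f => M /ST/Tf. Qed.

Lemma finitely_many_or (S T : (K -> Prop) -> Prop) :
  finitely_many S -> finitely_many T -> finitely_many (fun M => S M \/ T M).
Proof.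
move=> [n [f Sf]] [m [g Tg]].
exists (n + m)%N, (fun i => if (i < n)%N then f i else g (i - n)%N) => M [SM|TM].
  by have [i [lt_in Mf]] := Sf M SM; exists i; rewrite lt_in ltn_addr.
have [i [lt_im Mg]] := Tg M TM; exists (n + i)%N.
by rewrite ltn_add2l (ltnNge _ n) leq_addr /= addKn.
Qed.

Definition cofinitely_in (S : (K -> Prop) -> Prop) x :=
  Rsub x /\ finitely_many (fun M => S M /\ ~ M x).

(** A t-closed [M] that omits [x] must omit one of the finitely many elements witnessing [x] in the
    t-closure, so the exceptions for [x] lie in a finite union of finite families. *)
Lemma cofinitely_in_t_closed (S : (K -> Prop) -> Prop) :
  (forall M, S M -> t_maximal M) -> t_closed (cofinitely_in S).
Proof.
move=> St; have sM M : S M -> t_closed M by move=> /St[/t_ideal_closed].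
have sC : is_submod (cofinitely_in S).
  apply: is_submodP => [|x y [Rx fx] [Ry fy]|a x Ra [Rx fx]].
  - split; first exact: Rsub0.
    exists 0%N, (fun _ => @Rsub R) => M [/sM[sM' _] nM0]; case: nM0.
    exact: submod0.
  - split; first exact: RsubD.
    apply: finitely_many_sub (finitely_many_or fx fy) => M [SM nM].
    apply: contrapT => no; apply: nM; apply: submodD; first by case: (sM _ SM).
      by apply: contrapT => nM; apply: no; left.
    by apply: contrapT => nM; apply: no; right.
  - split; first exact: RsubM.
    apply: finitely_many_sub fx => M [SM nM]; split=> // Mx; apply: nM.
    by apply: submodM => //; case: (sM _ SM).
split=> // x tx; split.
  by apply: (proj2 (Rsub_t_closed R)); apply: tclos_mono tx => z [].
have /(tclosP _ sC)[s [Cs ns sx]] := tx.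
have fs : finitely_many (fun M => S M /\ exists2 g, g \in s & ~ M g).
  elim: s Cs {ns sx} => [_|g s IHs Cs].
    by exists 0%N, (fun _ => @Rsub R) => M [_ []].
  have fs : finitely_many (fun M => S M /\ exists2 g, g \in s & ~ M g).
    by apply: IHs => h hs; apply: Cs; rewrite inE hs orbT.
  have [_ fg] := Cs g (mem_head _ _).
  apply: finitely_many_sub (finitely_many_or fg fs) => M [SM [h]].
  rewrite inE => /orP[/eqP->|hs] nMh; [by left|right].
  by split=> //; exists h.
apply: finitely_many_sub fs => M [SM nMx]; split=> //.
apply: contrapT => sM'; apply: nMx; have [sM'' tM] := sM _ SM; apply: tM.
apply/tclosP => //; exists s; split=> // g gs.
by apply: contrapT => nMg; apply: sM'; exists g.
Qed.

Lemma principal_submod r : is_submod (fun z : K => exists2 k, Rsub k & z = r * k).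
Proof.
apply: is_submodP => [|_ _ [k Rk ->] [l Rl ->]|a _ Ra [k Rk ->]].
- by exists 0; [apply: Rsub0|rewrite mulr0].
- by exists (k + l); [apply: RsubD|rewrite mulrDr].
- by exists (a * k); [apply: RsubM|rewrite mulrCA].
Qed.

Lemma tRTP_escape (r : K) M : PvMD R -> unique_t_max_over_t_primes R ->
  tRTP R -> t_maximal M -> M r -> r != 0 ->
  exists2 c, outside M c & forall N, t_maximal N -> N r -> N <> M -> N c.
Proof.
move=> pv uniq rtp tM Mr nz_r.
have vM := PvMD_t_maximal pv tM; have [pM _] := vM.
have Rr := prime_sub pM Mr.
pose rR (z : K) := exists2 k, Rsub k & z = r * k.
have srR : is_submod rR := principal_submod r.
have rRM : subsetK rR M.
  by move=> _ [k Rk ->]; apply: submodMr => //; apply: prime_submod.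
pose P := local_radical rR M.
have pP : prime_ideal P by apply: local_radical_prime.
have PM : subsetK P M by apply: local_radical_sub.
have vP := valued_prime_sub pP vM PM.
have Pr : P r.
  apply: sub_local_radical => //; first by move=> x /rRM; apply: prime_sub.
  by exists 1; [apply: Rsub1|rewrite mulr1].
have tP : t_prime P by apply: valued_prime_t_prime => //; exists r.
have onlyM N : t_maximal N -> subsetK P N -> N = M.
  by move=> tN PN; apply/predeqP; apply: (proj2 (uniq P tP)).
(* The square matters: [r ^+ 2] lies in [I], whereas [r] is not in [r ^+ 2 * loc P], because [r] is
   no unit there. *)
pose I z := Rsub z /\ exists2 s, outside M s & exists2 k, Rsub k & s * z = r ^+ 2 * k.
have sI' := localized_submod pM (principal_submod (r ^+ 2)).
have iI : ideal I.
  split; last by move=> z [].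
  apply: is_submodP => [|x y [Rx Ix] [Ry Iy]|a x Ra [Rx Ix]].
  - by split; [exact: Rsub0|apply: submod0 sI'].
  - by split; [exact: RsubD|apply: submodD sI' Ix Iy].
  - by split; [exact: RsubM|apply: submodM sI' Ra Ix].
have Ir2 : I (r ^+ 2).
  split; first exact: RsubX.
  by exists 1; [apply: outside1|exists 1; [apply: Rsub1|rewrite mul1r mulr1]].
have nI : nonzeroK I by exists (r ^+ 2); rewrite expf_neq0.
(* If [p ^+ n] is locally a multiple of [r], its square is one of [r ^+ 2]; so a t-maximal ideal
   over [I] contains [P] and equals [M]. *)
have I_escapes N : t_maximal N -> N <> M -> exists g, I g /\ ~ N g.
  move=> tN NM; apply: not_subsetK => IN; apply: NM; apply: onlyM => // p Pp.
  have [Rp [n [s [os [k Rk e]]]]] := Pp.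
  apply: (primeX (n := (n * 2)%N) (t_maximal_prime tN)) => //; apply: IN.
  split; first exact: RsubX.
  exists (s ^+ 2); first exact: outsideX.
  by exists (k ^+ 2); [apply: RsubX|rewrite exprM -!exprMn e].
have [x [Ix nPx]] : exists x, colon (@Rsub R) I x /\ ~ loc P x.
  apply: not_subsetK => Iloc.
  have sT : is_submod (trace I) by apply: prodK_submod; case: iI.
  have nT := trace_nonzero iI nI.
  have sL := localized_submod pP (principal_submod (r ^+ 2)).
  have T_sub : subsetK (trace I)
      (fun z => exists2 s, outside P s & exists2 k, Rsub k & s * z = r ^+ 2 * k).
    apply: prodK_sub => // i y [Ri [s os [k Rk e]]] /Iloc /(locP _ pP)[t ot Rt].
    exists (t * s); first by apply: outsideM => //; apply: outside_sub os.
    exists (k * (t * y)); first exact: RsubM.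
    have -> : t * s * (i * y) = s * i * (t * y) by ring.
    by rewrite e; ring.
  have nLr : ~ tclos (trace I) r.
    move=> /(tclos_loc vP sT)[s os /T_sub[t ot [k Rk e]]].
    have [_] := outsideM pP ot os; apply.
    have -> : t * s = r * k by apply: (mulIf nz_r); rewrite -mulrA e; ring.
    by apply: submodMr (prime_submod pP) Rk Pr.
  apply: nLr; have [JR|Jrad] := rtp I iI nI; first by apply/JR.
  by apply: (Jrad r Rr 2%N); apply: sub_tclos => //; apply: sub_trace.
have [c [d [Pc od xc]]] := not_locP vP nPx.
have [t [b [ot Pb tb]]] := change_denominator pP vM PM Pc od.
have nz_c : c != 0.
  by apply/eqP => c0; have := outside_neq0 pP od; rewrite -xc c0 mulr0 eqxx.
have {tb} xb : x * b = t.
  by apply: (mulIf nz_c); rewrite tb -xc; ring.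
have [Rb [n [s [os [k Rk e]]]]] := Pb.
(* Since [x * b = t], this element is [x ^+ n * (r * k)]. Multiplied by [g ^+ n] it becomes
   [r * k * (x * g) ^+ n], an element of [N] because [x * g] is in [R]; and [g] is outside [N]. *)
exists (t ^+ n * s); first by apply: outsideM => //; apply: outsideX.
move=> N tN Nr NM; have pN := t_maximal_prime tN.
have [g [Ig nNg]] := I_escapes N tN NM.
have [Rg _] := Ig; have og : outside N (g ^+ n) by apply: outsideX.
have Rts : Rsub (t ^+ n * s) by apply: RsubM; [apply: RsubX; case: ot|case: os].
have : N (g ^+ n * (t ^+ n * s)).
  rewrite (_ : _ * _ = r * (k * (x * g) ^+ n)).
    apply: submodMr => //; first exact: prime_submod.
    by apply: RsubM => //; apply/RsubX/Ix.
  have -> : t ^+ n * s = x ^+ n * (s * b ^+ n) by rewrite -xb exprMn; ring.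
  by rewrite e exprMn; ring.
by move=> /(primeM pN (proj1 og) Rts)[/(proj2 og)|].
Qed.

Lemma tRTP_finite_character : PvMD R -> unique_t_max_over_t_primes R ->
  tRTP R -> t_finite_character R.
Proof.
move=> pv uniq rtp r nz_r; rewrite -emb_neq0 in nz_r.
pose S M := t_maximal M /\ M (emb r).
have cC : t_closed (cofinitely_in S) by apply: cofinitely_in_t_closed => M [].
have Cr : cofinitely_in S (emb r).
  split; first by exists r.
  by exists 0%N, (fun _ => @Rsub R) => M [[_ Mr]].
have [[_ [n [f Sf]]]|pC] := EM (cofinitely_in S 1).
  exists n, f => M tM Mr; apply: Sf; split=> // M1.
  by case: tM => _ [+ _]; apply.
have [M tM CM] : exists2 M, t_maximal M & subsetK (cofinitely_in S) M.
  apply: t_ideal_in_t_maximal => //; apply: t_closed_ideal => //; last by move=> x [].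
  by exists (emb r).
have [c [Rc nMc] cN] := tRTP_escape pv uniq rtp tM (CM _ Cr) nz_r.
case: nMc; apply: CM; split=> //.
(* Among the t-maximal ideals over [r], only [M] can omit [c], so [c] has finitely many exceptions
   and would lie in [M]. *)
exists 1%N, (fun _ => M) => N [[tN Nr] nNc]; exists 0%N; split=> // x.
suff -> : N = M by [].
by apply: contrapT => NM; apply: nNc; apply: cN.
Qed.

End MainImplications.

Theorem theorem1p12 (R : idomainType) :
  not_field R -> PvMD R ->
  (weakly_Matlis R -> t_finite_character R) /\
  (t_finite_character R -> t_sharpsharp R) /\
  (t_sharpsharp R -> tRTP R) /\
  (unique_t_max_over_t_primes R ->
     (weakly_Matlis R <-> t_finite_character R) /\
     (t_finite_character R <-> t_sharpsharp R) /\
     (t_sharpsharp R <-> tRTP R)).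
Proof.
move=> _ pv.
have i_ii : weakly_Matlis R -> t_finite_character R by case.
have ii_iii := finite_character_sharpsharp pv.
have iii_iv := sharpsharp_tRTP pv.
do 3!split=> //; move=> uniq.
have iv_ii := tRTP_finite_character pv uniq.
by do !split=> //; auto.
Qed.
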